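(* For any complete Heyting algebra $\mathbb{H}$, any set $U$ and any $\mathbb{H}$-fuzzy relation $R$ on $U$, the algebra of rough $\mathbb{H}$-sets, i.e. the complete Heyting algebra $\mathbb{H}^U$ equipped with the operations ${}^{\blacktriangle},{}^{\blacktriangledown},{}^{\vartriangle},{}^{\triangledown}$ determined by $R$, is an H2GC+FS-algebra, where ${}^{\blacktriangle},{}^{\triangledown},{}^{\vartriangle},{}^{\blacktriangledown}$ play the roles of ${}^{\blacktriangleright},{}^{\vartriangleleft},{}^{\vartriangleright},{}^{\blacktriangleleft}$, respectively.
   Context: Let $\mathbb{H}=(H,\vee,\wedge,\to,0)$ be a complete Heyting algebra and $U$ a set. $\mathbb{H}^U$ denotes the complete Heyting algebra of all maps $U\to H$ (called $\mathbb{H}$-sets) with pointwise operations and order. An $\mathbb{H}$-fuzzy relation on $U$ is a map $R\colon U\times U\to H$. For an $\mathbb{H}$-set $\varphi$ and $x\in U$ put $\varphi^{\blacktriangle}(x)=\bigvee_{y\in U}(R(x,y)\wedge\varphi(y))$, $\varphi^{\blacktriangledown}(x)=\bigwedge_{y\in U}(R(x,y)\to\varphi(y))$, $\varphi^{\vartriangle}(x)=\bigvee_{y\in U}(R(y,x)\wedge\varphi(y))$, $\varphi^{\triangledown}(x)=\bigwedge_{y\in U}(R(y,x)\to\varphi(y))$. A pair $(f,g)$ of maps on an ordered set $P$ is a Galois connection on $P$ if $f(p)\le q\iff p\le g(q)$ for all $p,q\in P$. An H2GC-algebra is a Heyting algebra with four unary operations ${}^{\blacktriangleright},{}^{\vartriangleleft},{}^{\vartriangleright},{}^{\blacktriangleleft}$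 such that $({}^{\blacktriangleright},{}^{\vartriangleleft})$ and $({}^{\vartriangleright},{}^{\blacktriangleleft})$ are Galois connections on it. An H2GC+FS-algebra is an H2GC-algebra satisfying, for all $a,b$: $(a\to b)^{\blacktriangleright}\to(a^{\blacktriangleleft}\to b^{\blacktriangleright})=1$ and $(a\to b)^{\vartriangleright}\to(a^{\vartriangleleft}\to b^{\vartriangleright})=1$. *)

(* Defs.v *)
From HB Require Import structures.
From mathcomp Require Import all_boot all_order.
From mathcomp Require Import boolp classical_sets.

Set Implicit Arguments.
Unset Strict Implicit.
Unset Printing Implicit Defensive.

Import Order.Theory.

Reserved Notation "a `->` b" (at level 55, right associativity).

Local Open Scope classical_set_scope.
Local Open Scope order_scope.

HB.mixin Record TBLattice_isHeyting d T of Order.TBLattice d T := {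
  himp : T -> T -> T;
  himpP : forall a b c : T, (c <= himp a b) = (Order.meet c a <= b)
}.

#[short(type="heytingType")]
HB.structure Definition Heyting d :=
  { T of Order.TBLattice d T & TBLattice_isHeyting d T }.

Notation "a `->` b" := (himp a b) : order_scope.

HB.mixin Record Heyting_isComplete d T of Heyting d T := {
  csup : set T -> T;
  cinf : set T -> T;
  csupP : forall A : set T, supremums A (csup A);
  cinfP : forall A : set T, infimums A (cinf A)
}.

#[short(type="completeHeytingType")]
HB.structure Definition CompleteHeyting d :=
  { T of Heyting d T & Heyting_isComplete d T }.

(* The pointwise order, meet and join on [U -> H] come from [boolp]. *)
Section FunTBLattice.
Variables (U : Type) (d : Order.disp_t) (H : tbLatticeType d).

Fact funbot_le (f : U -> H) : (fun=> \bot : H) <= f.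
Proof. by apply/lefP => x; exact: le0x. Qed.

Fact funtop_ge (f : U -> H) : f <= (fun=> \top : H).
Proof. by apply/lefP => x; exact: lex1. Qed.

HB.instance Definition _ := Order.hasBottom.Build _ (U -> H) funbot_le.
HB.instance Definition _ := Order.hasTop.Build _ (U -> H) funtop_ge.

End FunTBLattice.

Section FunHeyting.
Variables (U : Type) (d : Order.disp_t) (H : heytingType d).

Definition funimp (f g : U -> H) : U -> H := fun x => f x `->` g x.

Fact funimpP (f g h : U -> H) : (h <= funimp f g) = (h `&` f <= g).
Proof.
by apply/lefP/lefP => hfg x; have := hfg x; rewrite meetfE /funimp himpP.
Qed.

HB.instance Definition _ := TBLattice_isHeyting.Build _ (U -> H) funimpP.

End FunHeyting.

Section FunCompleteHeyting.
Variables (U : Type) (d : Order.disp_t) (H : completeHeytingType d).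

Definition funsup (A : set (U -> H)) : U -> H :=
  fun x => csup [set f x | f in A].
Definition funinf (A : set (U -> H)) : U -> H :=
  fun x => cinf [set f x | f in A].

Fact funsupP (A : set (U -> H)) : supremums A (funsup A).
Proof.
split=> [f Af|g gA]; apply/lefP => x; have [ub lub] := csupP [set h x | h in A].
  by apply: ub; exists f.
by apply: lub => _ [f Af <-]; exact/lefP/gA.
Qed.

Fact funinfP (A : set (U -> H)) : infimums A (funinf A).
Proof.
split=> [f Af|g gA]; apply/lefP => x; have [lb glb] := cinfP [set h x | h in A].
  by apply: lb; exists f.
by apply: glb => _ [f Af <-]; exact/lefP/gA.
Qed.

HB.instance Definition _ := Heyting_isComplete.Build _ (U -> H) funsupP funinfP.

End FunCompleteHeyting.

Definition galois_connection d (P : porderType d) (f g : P -> P) : Prop :=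
  forall p q : P, f p <= q <-> p <= g q.

(* The operations are taken in the order ▸, ◃, ▹, ◂, so that the Galois
   connections are (r, tl) and (tr, l), and the Fischer Servi-type axioms pair
   r with l and tr with tl. *)
Record H2GC_algebra d (L : heytingType d) (r tl tr l : L -> L) : Prop := {
  H2GC_galois1 : galois_connection r tl;
  H2GC_galois2 : galois_connection tr l
}.

Record H2GCFS_algebra d (L : heytingType d) (r tl tr l : L -> L) : Prop := {
  H2GCFS_H2GC : H2GC_algebra r tl tr l;
  H2GCFS_FS1 : forall a b : L, r (a `->` b) `->` (l a `->` r b) = \top;
  H2GCFS_FS2 : forall a b : L, tr (a `->` b) `->` (tl a `->` tr b) = \top
}.

Section RoughOperators.
Variables (U : Type) (d : Order.disp_t) (H : completeHeytingType d).
Variable R : U -> U -> H.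

(* ▲ *)
Definition rough_upper (phi : U -> H) : U -> H :=
  fun x => csup (range (fun y => R x y `&` phi y)).
(* ▼ *)
Definition rough_lower (phi : U -> H) : U -> H :=
  fun x => cinf (range (fun y => R x y `->` phi y)).
(* △ *)
Definition rough_upper_inv (phi : U -> H) : U -> H :=
  fun x => csup (range (fun y => R y x `&` phi y)).
(* ▽ *)
Definition rough_lower_inv (phi : U -> H) : U -> H :=
  fun x => cinf (range (fun y => R y x `->` phi y)).

End RoughOperators.

(* Main.v *)
Require Import Defs.
From mathcomp Require Import all_boot all_order.
From mathcomp Require Import boolp classical_sets.

Set Implicit Arguments.
Unset Strict Implicit.
Unset Printing Implicit Defensive.

Import Order.Theory.
Local Open Scope classical_set_scope.
Local Open Scope order_scope.

(** The order on [U -> H] is pointwise, and comparison with a supremum or infimum reduces to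
    comparison with each term. The adjunction ([rough_galois]) is then residuation in [H], point by
    point, and the Fischer Servi axiom ([rough_FS]) is modus ponens used twice. The other adjunction
    and axiom are the same facts for the converse relation. *)

Section CompleteHeytingTheory.
Variables (d : Order.disp_t) (H : completeHeytingType d).

Lemma csup_range_leP (I : Type) (F : I -> H) (z : H) :
  csup (range F) <= z <-> forall i, F i <= z.
Proof.
have [ub lub] := csupP (range F); split=> [supz i|Fz].
  by apply: le_trans supz; apply: ub; exists i.
by apply: lub => _ [i _ <-].
Qed.

Lemma le_cinf_rangeP (I : Type) (F : I -> H) (z : H) :
  z <= cinf (range F) <-> forall i, z <= F i.
Proof.
have [lb glb] := cinfP (range F); split=> [zinf i|zF].
  by apply: le_trans zinf _; apply: lb; exists i.
by apply: glb => _ [i _ <-].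
Qed.

End CompleteHeytingTheory.

Lemma himp_eq1 d (H : heytingType d) (a b : H) : (a `->` b == \top) = (a <= b).
Proof. by rewrite -le1x himpP meet1x. Qed.

Lemma himp_mp d (H : heytingType d) (a b : H) : (a `->` b) `&` a <= b.
Proof. by rewrite -himpP. Qed.

(** Both inequalities amount to [R x y]&[f y <= g x] for all [x] and [y]. *)
Lemma rough_galois d (H : completeHeytingType d) (U : Type) (R : U -> U -> H) :
  galois_connection (rough_upper R) (rough_lower_inv R).
Proof.
move=> f g; split=> /lefP fg; apply/lefP => x.
  apply/le_cinf_rangeP => y; rewrite himpP meetC.
  by move/csup_range_leP: (fg y); exact.
apply/csup_range_leP => y; rewrite meetC -himpP.
by move/le_cinf_rangeP: (fg y); exact.
Qed.

Lemma rough_FS d (H : completeHeytingType d) (U : Type) (R : U -> U -> H)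
    (a b : U -> H) :
  rough_upper R (a `->` b) `->` (rough_lower R a `->` rough_upper R b) = \top.
Proof.
apply/eqP; rewrite himp_eq1; apply/lefP => x.
apply/csup_range_leP => y; rewrite himpP.
(* Reflexivity, read through the universal properties, bounds the infimum and the supremum by their
   terms at [y]. *)
have le_lower : rough_lower R a x <= R x y `->` a y.
  by move/le_cinf_rangeP: (lexx (rough_lower R a x)); exact.
have le_upper : R x y `&` b y <= rough_upper R b x.
  by move/csup_range_leP: (lexx (rough_upper R b x)); exact.
apply: le_trans le_upper; apply: le_trans (leI2 (lexx _) le_lower) _.
(* Idempotence duplicates [R x y]: one copy is consumed to derive [a y], the other stays for the
   conclusion. *)
have -> : R x y `&` (a `->` b) y `&` (R x y `->` a y) =
          R x y `&` ((a y `->` b y) `&` ((R x y `->` a y) `&` R x y)).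
  by rewrite [_ `&` R x y]meetC (meetCA (a y `->` b y)) !meetA meetxx.
(* [R x y] yields [a y], which in turn yields [b y]. *)
apply: leI2 (lexx _) _; apply: le_trans (himp_mp (a y) (b y)).
exact: leI2 (lexx _) (himp_mp _ _).
Qed.

Theorem proposition3p2 (d : Order.disp_t) (H : completeHeytingType d)
    (U : Type) (R : U -> U -> H) :
  @H2GCFS_algebra _ (U -> H : heytingType _)
    (rough_upper R) (rough_lower_inv R) (rough_upper_inv R) (rough_lower R).
Proof.
(* [rough_upper_inv R] and [rough_lower R] are [rough_upper] and
   [rough_lower_inv] of the converse relation. *)
split; first split.
- exact: rough_galois.
- exact: (rough_galois (fun x y => R y x)).
- exact: rough_FS.
- exact: (rough_FS (fun x y => R y x)).
Qed.
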